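(* For every integer $n\geq 6$ there exists a nonempty collection of quadratic forms $\{p_1,\ldots,p_r\}\subset\mathbb{R}[x_1,\ldots,x_n]$ such that the system $p_1=p_2=\cdots=p_r=0$ has no nontrivial solution in $\mathbb{R}^n$, and such that for all positive real coefficients $a_1,\ldots,a_r$ the form $f=\sum_{j=1}^r a_jp_j^2$ is a noncoercive sum of squares.
   Context: A form is a homogeneous polynomial; all polynomials are taken to be forms. A form $f\in\mathbb{R}[x_1,\ldots,x_n]$ is a sum of squares if there exist $q_1,\ldots,q_m\in\mathbb{R}[x_1,\ldots,x_n]$ with $f=\sum_{k=1}^m q_k^2$. A sum of squares $f\in\mathbb{R}[x_1,\ldots,x_n]$ is called noncoercive if for every representation $f=\sum_{k=1}^m q_k^2$ with $q_1,\ldots,q_m\in\mathbb{R}[x_1,\ldots,x_n]$ the system $q_1=\cdots=q_m=0$ has a solution $\mathbf{a}\in\mathbb{C}^n\setminus\{\mathbf{0}\}$. *)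

(* Defs.v *)
From mathcomp Require Import all_boot all_order all_algebra.
From mathcomp Require Import reals complex mpoly.

Set Implicit Arguments.
Unset Strict Implicit.
Unset Printing Implicit Defensive.

Import GRing.Theory Num.Theory.
Local Open Scope ring_scope.

Definition form (K : comNzRingType) (n : nat) (f : {mpoly K[n]}) : Prop :=
  exists d : nat, f \is d.-homog.

Definition nontrivial_zero (K : comNzRingType) (n m : nat)
    (q : 'I_m -> {mpoly K[n]}) (a : 'I_n -> K) : Prop :=
  (exists i, a i != 0) /\ forall k, (q k).@[a] = 0.

(* The summands are arbitrary polynomials; when f is a form they are
   automatically forms, because leading and trailing homogeneous parts of real
   squares cannot cancel. *)
Definition sos_rep (R : realType) (n m : nat)
    (f : {mpoly R[n]}) (q : 'I_m -> {mpoly R[n]}) : Prop :=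
  f = \sum_(k < m) q k ^+ 2.

Definition sum_of_squares (R : realType) (n : nat) (f : {mpoly R[n]}) : Prop :=
  form f /\ exists (m : nat) (q : 'I_m -> {mpoly R[n]}), sos_rep f q.

Definition complexify (R : realType) (n : nat) (f : {mpoly R[n]}) :
    {mpoly (complex R)[n]} :=
  map_mpoly (real_complex R) f.

Definition noncoercive_sos (R : realType) (n : nat) (f : {mpoly R[n]}) : Prop :=
  sum_of_squares f /\
  forall (m : nat) (q : 'I_m -> {mpoly R[n]}), sos_rep f q ->
    exists a : 'I_n -> complex R,
      nontrivial_zero (fun k => complexify (q k)) a.

(* Main.v *)
Require Import Defs.
From mathcomp Require Import all_boot all_order all_algebra.
From mathcomp Require Import reals complex mpoly.
From mathcomp Require Import ring lra.

(** The proof is a separation argument.  Suppose that a linear functional [L] on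
    quartic forms satisfies [L (q ^+ 2) >= 0] for every quadratic form [q], and
    let [W] be the space of quadratic forms with [L (q ^+ 2) = 0].  If
    [p_1, ..., p_r] lie in [W], then [L] kills every [f = \sum_j a_j p_j^2], so
    the summands of any representation [f = \sum_k q_k^2] lie in [W] as well
    (they are quadratic forms by [sos_homog]).  It is therefore enough to find
    an [L] for which the members of [W] share a nonreal zero but no real one.

    The functional comes from a 5-cycle.  Its vertices carry the variables
    [{x_0, x_1}], [x_2], [x_3], [x_4], [x_5] in this cyclic order: the first
    vertex carries two variables, which enter through [x_0^2 + x_1^2].  Write
    [d_i] for the coefficient of [x_i^2] in [q] and [b_ij] for that of [x_i x_j].
    The functional is chosen so that [L (q ^+ 2)] is a sum of squares of
    - the [b_ij] with [x_i], [x_j] on adjacent vertices, together with [b_01] and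
      [d_0 - d_1];
    - three linear forms in [(d_0 + d_1, d_2, d_3, d_4, d_5)].
    The Gram matrix of those three forms must have zeros at the non-edges and
    positive entries at the edges; it is obtained from the vectors
    [(1,0,0), (1,1,-1), (0,1,0), (0,1,1), (1,0,1)], in which two vertices are
    orthogonal exactly when they are not adjacent.

    On [W] we have [d_0 = d_1] and [b_01 = 0], which says that the form
    vanishes at [(1, 'i, 0, ..., 0)] ([complexify_zero]); this is the common
    complex zero.  Conversely [W] contains the products of variables on
    non-adjacent vertices and two diagonal forms annihilated by the three linear
    forms.  At a common real zero the products force the support into an edge
    of the cycle, and on each edge some combination of the two diagonal forms is
    positive definite, so the zero is trivial.  In more than six variables the
    squares of the additional variables are added to the list: [L] ignores those
    variables, and the complex zero does not involve them. *)

Import Order.TTheory GRing.Theory Num.Theory.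
Local Open Scope ring_scope.

(** * Quadratic forms *)
Lemma mdeg2_split {n : nat} (m : 'X_{1..n}) :
  mdeg m = 2%N -> exists k l, m = (U_(k) + U_(l))%MM.
Proof.
move=> m2; have [k mk]: exists k, (U_(k) <= m)%MM.
  have: m != 0%MM by rewrite -mdeg_eq0 m2.
  case: (boolP [exists k, m k != 0%N]) => [/existsP[k mk] _|].
    by exists k; rewrite lep1mP.
  rewrite negb_exists => /forallP m0 /eqP[]; apply/mnmP=> k.
  by rewrite mnm0E; apply/eqP; have := m0 k; rewrite negbK.
have /mdeg1P[l /eqP ml] : mdeg (m - U_(k))%MM == 1%N.
  by rewrite -(eqn_add2r (mdeg U_(k))) -mdegD submK // m2 mdeg1.
by exists k, l; rewrite addmC -ml submK.
Qed.

Lemma dhomog2_expand {K : comNzRingType} {n : nat} (q : {mpoly K[n]}) :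
  q \is 2.-homog ->
  exists c : 'I_n -> 'I_n -> K, q = \sum_k \sum_l c k l *: ('X_k * 'X_l).
Proof.
pose P (q : {mpoly K[n]}) := exists c : 'I_n -> 'I_n -> K,
  q = \sum_k \sum_l c k l *: ('X_k * 'X_l).
move=> /dhomogP hq; rewrite -/(P q) [q]mpolyE big_seq.
apply: (big_ind P) => [|_ _ [b ->] [c ->]|m /hq /mdeg2_split[i [j mE]]].
- exists (fun _ _ => 0).
  by rewrite big1 // => k _; rewrite big1 // => l _; rewrite scale0r.
- exists (fun k l => b k l + c k l).
  rewrite -big_split; apply: eq_bigr => k _; rewrite -big_split.
  by apply: eq_bigr => l _; rewrite scalerDl.
- exists (fun k l => q@_m * (k == i)%:R * (l == j)%:R).
  rewrite (bigD1 i) //= (bigD1 j) //= !eqxx !mulr1 -mpolyXD -mE.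
  rewrite !big1 ?addr0 // => [k /negPf ki|l /negPf lj].
    by rewrite big1 // => l _; rewrite ki mulr0 mul0r scale0r.
  by rewrite lj mulr0 scale0r.
Qed.

Lemma meval_bilinear {K : comNzRingType} {n : nat} (c : 'I_n -> 'I_n -> K)
    (u : 'I_n -> K) :
  (\sum_k \sum_l c k l *: ('X_k * 'X_l)).@[u] =
    \sum_k \sum_l c k l * (u k * u l).
Proof.
rewrite (raddf_sum (meval u)); apply: eq_bigr => k _.
rewrite (raddf_sum (meval u)); apply: eq_bigr => l _.
by rewrite /= mevalZ mevalM !mevalXU.
Qed.

(** The ring morphism is there because the same expansion is needed both over
    the reals and at a complex combination of two real points. *)
Lemma meval_map_dhomog2 {K L : comNzRingType} (phi : {rmorphism K -> L})
    {n : nat} (q : {mpoly K[n]}) (v w : 'I_n -> K) (a b : L) :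
  q \is 2.-homog ->
  (map_mpoly phi q).@[fun i => a * phi (v i) + b * phi (w i)] =
    a ^+ 2 * phi q.@[v] + b ^+ 2 * phi q.@[w] +
    a * b * phi (q.@[fun i => v i + w i] - q.@[v] - q.@[w]).
Proof.
case/dhomog2_expand=> c ->.
have -> : map_mpoly phi (\sum_k \sum_l c k l *: ('X_k * 'X_l)) =
    \sum_k \sum_l phi (c k l) *: ('X_k * 'X_l).
  rewrite raddf_sum; apply: eq_bigr => k _; rewrite raddf_sum.
  by apply: eq_bigr => l _; rewrite /= map_mpolyZ rmorphM /= !map_mpolyX.
rewrite !meval_bilinear !rmorphB /= !rmorph_sum /=.
rewrite -!sumrB !mulr_sumr -!big_split; apply: eq_bigr => k _ /=.
rewrite !rmorph_sum /= -!sumrB !mulr_sumr -!big_split.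
by apply: eq_bigr => l _ /=; rewrite !rmorphM !rmorphD; ring.
Qed.

Lemma meval_dhomog2 {K : comNzRingType} {n : nat} (q : {mpoly K[n]})
    (v w : 'I_n -> K) (a b : K) :
  q \is 2.-homog ->
  q.@[fun i => a * v i + b * w i] =
    a ^+ 2 * q.@[v] + b ^+ 2 * q.@[w] +
    a * b * (q.@[fun i => v i + w i] - q.@[v] - q.@[w]).
Proof.
move=> hq; have := @meval_map_dhomog2 _ _ idfun _ q v w a b hq.
by have -> : map_mpoly idfun q = q by apply/mpolyP=> m; rewrite mcoeff_map_mpoly.
Qed.

(** * Summands of a homogeneous sum of squares *)

(** When [m0 + m0] is a sum of two monomials of [q] in only one way, no cross
    term contributes to its coefficient. *)
Lemma mcoeff_sqr_isolated {K : comNzRingType} {n : nat} (q : {mpoly K[n]})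
    (m0 : 'X_{1..n}) :
  (forall m1 m2, m1 \in msupp q -> m2 \in msupp q ->
     (m1 + m2 = m0 + m0)%MM -> m1 = m0) ->
  (q ^+ 2)@_(m0 + m0) = q@_m0 ^+ 2.
Proof.
move=> iso; rewrite expr2 mpolyME raddf_sum /=.
have [qm0|qm0] := boolP (m0 \in msupp q).
  rewrite (bigD1_seq (m0, m0)) /=; first last.
  - by rewrite allpairs_uniq => // -[? ?] [].
  - by rewrite allpairs_f.
  rewrite mcoeffZ mcoeffX eqxx mulr1 big_seq_cond big1 ?addr0 ?expr2 //.
  move=> _ /andP[/allpairsP[[m1 m2] /= [h1 h2 ->]] ne] /=.
  rewrite mcoeffZ mcoeffX; case: eqP => [e|]; last by rewrite mulr0.
  case/negP: ne; rewrite (iso _ _ h1 h2 e) (iso _ _ h2 h1) // addmC //.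
rewrite (memN_msupp_eq0 qm0) expr0n big_seq big1 //.
move=> _ /allpairsP[[m1 m2] /= [h1 h2 ->]] /=.
rewrite mcoeffZ mcoeffX; case: eqP => [e|]; last by rewrite mulr0.
by rewrite -(iso _ _ h1 h2 e) h1 in qm0.
Qed.

Lemma seq_extremum {T : eqType} (r : rel T) (s : seq T) :
  total r -> transitive r -> s != [::] ->
  exists2 x, x \in s & {in s, forall y, r x y}.
Proof.
move=> rtot rtr; rewrite -size_eq0 -(size_sort r) => s0.
have := sort_sorted rtot s; have := mem_sort r s.
case: (sort r s) s0 => // x t _ mem; rewrite /= path_sortedE // => /andP[xt _].
exists x => [|y]; first by rewrite -mem inE eqxx.
rewrite -mem inE => /predU1P[->|/(allP xt) //].
by have := rtot x x; rewrite orbb.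
Qed.

(** The smallest and the largest monomial (for a degree-compatible order) among
    all the summands are isolated in the sense of [mcoeff_sqr_isolated].  The
    coefficient of the double of such a monomial in the sum is thus a sum of
    squares that are not all zero, so this double occurs in the sum and the
    monomial has degree [d]; every other monomial lies between the two. *)
Lemma sos_homog {R : realDomainType} {n m d : nat} (q : 'I_m -> {mpoly R[n]}) :
  \sum_(k < m) q k ^+ 2 \is (d + d).-homog -> forall k, q k \is d.-homog.
Proof.
move=> /dhomogP hf k; pose S := flatten [seq msupp (q k) | k : 'I_m].
have inS j x : x \in msupp (q j) -> x \in S.
  by move=> ?; apply/flatten_mapP; exists j; rewrite ?mem_enum.
have isolated_deg x : x \in S -> (forall m1 m2, m1 \in S -> m2 \in S ->
    (m1 + m2 = x + x)%MM -> m1 = x) -> mdeg x = d.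
  move=> /flatten_mapP[j _ xj] iso.
  (* The double of x survives in the sum, whose degree is d + d. *)
  suff /hf/(etrans (esym (mdegD _ _))) :
      (x + x)%MM \in msupp (\sum_(k < m) q k ^+ 2).
    by rewrite !addnn => /double_inj.
  rewrite mcoeff_msupp raddf_sum /= (eq_bigr (fun k => (q k)@_x ^+ 2)).
    rewrite psumr_neq0 => [|i _]; last exact: sqr_ge0.
    apply/hasP; exists j; first exact: mem_index_enum.
    by rewrite /= lt_neqAle sqr_ge0 andbT eq_sym sqrf_eq0 -mcoeff_msupp.
  move=> i _; apply: mcoeff_sqr_isolated => m1 m2 /inS h1 /inS h2.
  exact: iso.
apply/dhomogP => x /inS xS.
have S0 : S != [::] by apply: contraTneq xS => ->.
have [lo loS loP] := seq_extremum <=%O S le_total le_trans S0.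
have [hi hiS hiP] := seq_extremum >=%O S ge_total ge_trans S0.
have hi_deg : mdeg hi = d.
  apply: isolated_deg => // m1 m2 /hiP h1 /hiP h2 e.
  apply: le_anti; apply/andP; split=> //; rewrite leNgt; apply/negP => lt1.
  by have := ltmc_le_add lt1 h2; rewrite e ltxx.
have lo_deg : mdeg lo = d.
  apply: isolated_deg => // m1 m2 /loP h1 /loP h2 e.
  apply: le_anti; apply/andP; split=> //; rewrite leNgt; apply/negP => lt1.
  by have := ltmc_le_add lt1 h2; rewrite e ltxx.
apply/eqP; rewrite eqn_leq; apply/andP; split.
  by rewrite -hi_deg; apply: lemc_mdeg (hiP _ xS).
by rewrite -lo_deg; apply: lemc_mdeg (loP _ xS).
Qed.

(** * The functional attached to the 5-cycle *)
Definition unitv {K : pzRingType} {n : nat} (i : 'I_n) : 'I_n -> K :=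
  fun k => (k == i)%:R.

Definition diag_coef {R : fieldType} {n : nat} (q : {mpoly R[n]}) (i : 'I_n) : R :=
  q.@[unitv i].

(** For a quadratic form and [i != j] this is the coefficient of [x_i x_j]. *)
Definition polar_coef {R : fieldType} {n : nat} (q : {mpoly R[n]}) (i j : 'I_n) : R :=
  q.@[fun k => unitv i k + unitv j k] - q.@[unitv i] - q.@[unitv j].

(** For a quartic form and [i != j] this is the coefficient of
    [x_i^2 x_j^2]: averaging over the sign of [x_j] removes the monomials
    [x_i^3 x_j] and [x_i x_j^3], and the pure powers are subtracted.  Evaluations
    are easier to handle than coefficients of a product. *)
Definition cross_coef {R : fieldType} {n : nat} (f : {mpoly R[n]})
    (i j : 'I_n) : R :=
  (f.@[fun k => unitv i k + unitv j k] + f.@[fun k => unitv i k - unitv j k]) / 2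
  - f.@[unitv i] - f.@[unitv j].

Lemma cross_coef_sqr {R : numFieldType} {n : nat} (q : {mpoly R[n]}) (i j : 'I_n) :
  q \is 2.-homog ->
  cross_coef (q ^+ 2) i j =
    2 * diag_coef q i * diag_coef q j + polar_coef q i j ^+ 2.
Proof.
move=> hq; have := meval_dhomog2 q (unitv i) (unitv j) 1 (-1) hq.
rewrite (meval_eq _ (v2 := fun k => unitv i k - unitv j k)) => [e|k]; last by ring.
rewrite /cross_coef /diag_coef /polar_coef !rmorphXn /= {}e.
by field.
Qed.

(** The last sum runs over the edges of the cycle, an edge at the first vertex
    counting once for each of the two variables there.  The weights of [d 2],
    [d 3], [d 4], [d 5] are the squared norms of the vectors attached to the
    vertices.  The first vertex has a unit vector; [3 / 2] and [1 / 2] are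
    the weights for which the contribution of [x_0] and [x_1] alone to
    [L (q ^+ 2)] is
    [(d_0 + d_1)^2 + ((d_0 - d_1)^2 + b_01^2) / 2]. *)
Definition pentagon_functional {R : fieldType} {n : nat} (x : 'I_6 -> 'I_n)
    (f : {mpoly R[n]}) : R :=
  let d i := f.@[unitv (x i)] in
  let b i j := cross_coef f (x i) (x j) in
  3 / 2 * (d 0 + d 1) + 3 * d 2 + d 3 + 2 * d 4 + 2 * d 5
  + b 0 1 / 2 + (b 0 2 + b 1 2 + b 2 3 + b 3 4 + b 4 5 + b 5 0 + b 5 1).

Lemma pentagon_functional_sqr {R : numFieldType} {n : nat} (x : 'I_6 -> 'I_n)
    (q : {mpoly R[n]}) (d := fun i => diag_coef q (x i))
    (b := fun i j => polar_coef q (x i) (x j)) :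
  q \is 2.-homog ->
  pentagon_functional x (q ^+ 2) =
    ((d 0 - d 1) ^+ 2 + b 0 1 ^+ 2) / 2
    + (b 0 2 ^+ 2 + b 1 2 ^+ 2 + b 2 3 ^+ 2 + b 3 4 ^+ 2 + b 4 5 ^+ 2
       + b 5 0 ^+ 2 + b 5 1 ^+ 2)
    + (d 0 + d 1 + d 2 + d 5) ^+ 2 + (d 2 + d 3 + d 4) ^+ 2
    + (d 4 + d 5 - d 2) ^+ 2.
Proof.
move=> hq; rewrite /pentagon_functional !cross_coef_sqr // !rmorphXn /=.
rewrite -/(diag_coef _ _) /d /b /diag_coef.
by field.
Qed.

Lemma pentagon_functional_linear {R : fieldType} {n : nat} (x : 'I_6 -> 'I_n)
    (a : R) (f g : {mpoly R[n]}) :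
  pentagon_functional x (a *: f + g) =
    a * pentagon_functional x f + pentagon_functional x g.
Proof.
rewrite /pentagon_functional /cross_coef !mevalD !mevalZ; ring.
Qed.

Lemma pentagon_functional_sum {R : fieldType} {n m : nat} (x : 'I_6 -> 'I_n)
    (a : 'I_m -> R) (f : 'I_m -> {mpoly R[n]}) :
  pentagon_functional x (\sum_j a j *: f j) =
    \sum_j a j * pentagon_functional x (f j).
Proof.
have L0 : pentagon_functional x (0 : {mpoly R[n]}) = 0.
  have := pentagon_functional_linear x (-1) (0 : {mpoly R[n]}) 0.
  by rewrite scaler0 addr0 mulN1r addNr.
apply: (big_ind2 (fun f s => pentagon_functional x f = s)) => // [f1 s1 f2 s2|j _].
  by rewrite -[f1]scale1r pentagon_functional_linear mul1r => <- <-; rewrite scale1r.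
by rewrite -[_ *: _]addr0 pentagon_functional_linear L0 addr0.
Qed.

Lemma pentagon_functional_sqr_ge0 {R : realFieldType} {n : nat}
    (x : 'I_6 -> 'I_n) (q : {mpoly R[n]}) :
  q \is 2.-homog -> 0 <= pentagon_functional x (q ^+ 2).
Proof.
move=> hq; rewrite pentagon_functional_sqr //.
by rewrite ?(addr_ge0, sqr_ge0, divr_ge0).
Qed.

Lemma pentagon_functional_sqr_eq0 {R : realFieldType} {n : nat}
    (x : 'I_6 -> 'I_n) (q : {mpoly R[n]}) :
  q \is 2.-homog -> pentagon_functional x (q ^+ 2) = 0 ->
  diag_coef q (x 0) = diag_coef q (x 1) /\ polar_coef q (x 0) (x 1) = 0.
Proof.
move=> hq; rewrite pentagon_functional_sqr //.
move/eqP; rewrite -!addrA paddr_eq0 ?(addr_ge0, sqr_ge0, divr_ge0) //.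
rewrite mulf_eq0 invr_eq0 pnatr_eq0 orbF paddr_eq0 ?sqr_ge0 // !sqrf_eq0 subr_eq0.
by move=> /andP[/andP[/eqP-> /eqP->] _].
Qed.

(** At [e_i + 'i e_j] a quadratic form takes the value
    [d_i - d_j + 'i b_ij]. *)
Lemma complexify_zero {R : realType} {n : nat} (i j : 'I_n) (q : {mpoly R[n]}) :
  q \is 2.-homog ->
  diag_coef q i = diag_coef q j -> polar_coef q i j = 0 ->
  (complexify q).@[fun k => (unitv i k)%:C%C + 'i%C * (unitv j k)%:C%C] = 0.
Proof.
move=> hq dE bE; rewrite /complexify.
have := meval_map_dhomog2 (real_complex R) q (unitv i) (unitv j) 1 'i%C hq.
rewrite -/(diag_coef q i) -/(diag_coef q j) -/(polar_coef q i j) dE bE.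
rewrite sqr_i rmorph0 mulr0 addr0 expr1n mul1r mulN1r subrr.
by apply: etrans; apply: meval_eq => k; rewrite mul1r.
Qed.

(** * The quadratic forms *)

(** The products run over the non-edges of the cycle.  The coefficients of the
    two diagonal forms span the vectors [(d_0 + d_1, d_2, d_3, d_4, d_5)] killed
    by the three linear forms of [pentagon_functional_sqr]. *)
Definition pentagon_quadrics {R : nzRingType} {n : nat} (x : 'I_6 -> 'I_n) :
    seq {mpoly R[n]} :=
  let X i := 'X_(x i) in
  [:: X 0 * X 3; X 1 * X 3; X 0 * X 4; X 1 * X 4; X 2 * X 4; X 2 * X 5; X 3 * X 5;
      X 0 ^+ 2 + X 1 ^+ 2 - 2 *: X 3 ^+ 2 + 2 *: X 4 ^+ 2 - 2 *: X 5 ^+ 2;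
      X 2 ^+ 2 - 3 *: X 3 ^+ 2 + 2 *: X 4 ^+ 2 - X 5 ^+ 2]
  ++ [seq 'X_i ^+ 2 | i in [predC codom x]].

Lemma pentagon_quadrics_homog {R : nzRingType} {n : nat} (x : 'I_6 -> 'I_n) :
  {in pentagon_quadrics (R := R) x, forall p, p \is 2.-homog}.
Proof.
have XX i j : ('X_i * 'X_j : {mpoly R[n]}) \is 2.-homog.
  by rewrite -mpolyXD dhomogX /= mdegD !mdeg1.
move=> p; rewrite mem_cat => /orP[|/imageP[i _ ->]]; last by rewrite expr2.
rewrite !inE !expr2.
by do !case/predU1P=> [->|]; rewrite ?(rpredB, rpredD, rpredZ, XX) // => /eqP->;
  rewrite ?(rpredB, rpredD, rpredZ, XX).
Qed.

Lemma pentagon_quadrics_kernel {R : numFieldType} {n : nat} (x : 'I_6 -> 'I_n) :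
  injective x ->
  {in pentagon_quadrics (R := R) x, forall p, pentagon_functional x (p ^+ 2) = 0}.
Proof.
move=> xI p hp; rewrite pentagon_functional_sqr; last first.
  exact: pentagon_quadrics_homog hp.
have e i j : (unitv (x i) (x j) : R) = (j == i)%:R by rewrite /unitv (inj_eq xI).
rewrite /diag_coef /polar_coef.
move: hp; rewrite mem_cat => /orP[|/imageP[i hi ->]]; last first.
  have e0 j : (unitv (x j) i : R) = 0.
    rewrite /unitv; case: eqP => // ij; move: hi.
    by rewrite inE /= ij codom_f.
  by rewrite !rmorphXn /= !mevalXU !e0; ring.
rewrite !inE.
do !case/predU1P=> [->|];
  rewrite ?(mevalD, mevalN, mevalZ, mevalM, rmorphXn) /= ?mevalXU ?e /=; try by ring.
move/eqP->.
by rewrite ?(mevalD, mevalN, mevalZ, mevalM, rmorphXn) /= ?mevalXU ?e /=; ring.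
Qed.

(** The case analysis on [u3] and [u4] follows the edges of the cycle in which
    the support of a zero can lie. *)
Lemma pentagon_system_trivial {R : realFieldType} (u0 u1 u2 u3 u4 u5 : R) :
  u0 * u3 = 0 -> u1 * u3 = 0 -> u0 * u4 = 0 -> u1 * u4 = 0 ->
  u2 * u4 = 0 -> u2 * u5 = 0 -> u3 * u5 = 0 ->
  u0 ^+ 2 + u1 ^+ 2 - 2 * u3 ^+ 2 + 2 * u4 ^+ 2 - 2 * u5 ^+ 2 = 0 ->
  u2 ^+ 2 - 3 * u3 ^+ 2 + 2 * u4 ^+ 2 - u5 ^+ 2 = 0 ->
  [/\ u0 = 0, u1 = 0 & u2 = 0] /\ [/\ u3 = 0, u4 = 0 & u5 = 0].
Proof.
have sq0 (z : R) : z ^+ 2 = 0 -> z = 0 by move=> /eqP; rewrite sqrf_eq0 => /eqP.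
have cancel (y z : R) : y != 0 -> z * y = 0 -> z = 0.
  by move=> /negPf y0 /eqP; rewrite mulf_eq0 y0 orbF => /eqP.
have [-> _ _|u3_neq0 /(cancel _ _ u3_neq0) -> /(cancel _ _ u3_neq0) ->] :=
    eqVneq u3 0; last first.
  move=> _ _ e24 _ /eqP; rewrite mulf_eq0 (negPf u3_neq0) /= => /eqP -> q1 q2.
  have u4E : u4 ^+ 2 = u3 ^+ 2 by lra.
  have u2E : u2 ^+ 2 = u3 ^+ 2 by lra.
  have /eqP : u3 ^+ 2 * u3 ^+ 2 = 0.
    by rewrite -{1}u2E -u4E -exprMn e24 expr0n.
  by rewrite mulf_eq0 orbb sqrf_eq0 (negPf u3_neq0).
have [->|u4_neq0] := eqVneq u4 0; last first.
  move=> /(cancel _ _ u4_neq0) -> /(cancel _ _ u4_neq0) -> /(cancel _ _ u4_neq0) ->.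
  move=> _ _ q1 q2.
  suff /sq0/eqP : u4 ^+ 2 = 0 by rewrite (negPf u4_neq0).
  lra.
move=> _ _ _ e25 _ q1 q2.
have u25 : u2 ^+ 2 = u5 ^+ 2 by lra.
have u5_0 : u5 = 0.
  apply/sq0/sq0; rewrite {1}expr2 -{1}u25 -exprMn e25 expr0n //.
rewrite {}u5_0 in q1 u25 *.
have u0_ge0 := sqr_ge0 u0; have u1_ge0 := sqr_ge0 u1.
by do !split; apply: sq0; lra.
Qed.

Lemma pentagon_quadrics_real_zero {R : realFieldType} {n : nat}
    (x : 'I_6 -> 'I_n) (v : 'I_n -> R) :
  (forall p, p \in pentagon_quadrics x -> p.@[v] = 0) -> forall i, v i = 0.
Proof.
move=> v0 i; have [/codomP[k ->]|xi] := boolP (i \in codom x); last first.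
  have : ('X_i ^+ 2 : {mpoly R[n]}).@[v] = 0.
    by apply: v0; rewrite mem_cat orbC image_f.
  by rewrite rmorphXn /= mevalXU => /eqP; rewrite sqrf_eq0 => /eqP.
(* The first nine members are the forms in the six variables of the cycle. *)
have core (p : {mpoly R[n]}) : p \in take 9 (pentagon_quadrics x) -> p.@[v] = 0.
  by move=> /mem_take /v0.
have [[v0E v1E v2E] [v3E v4E v5E]] : [/\ v (x 0) = 0, v (x 1) = 0 & v (x 2) = 0]
    /\ [/\ v (x 3) = 0, v (x 4) = 0 & v (x 5) = 0].
  apply: pentagon_system_trivial;
    rewrite -!mevalXU -?rmorphXn -?mevalM -?mevalZ -?mevalN -?mevalD;
    by apply: core; rewrite !inE eqxx ?orbT.
by case: k => -[|[|[|[|[|[|//]]]]]] hk;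
  [rewrite -[RHS]v0E|rewrite -[RHS]v1E|rewrite -[RHS]v2E
  |rewrite -[RHS]v3E|rewrite -[RHS]v4E|rewrite -[RHS]v5E];
  congr (v (x _)); apply: val_inj.
Qed.

(** * The theorem *)
Theorem corollary1p5 (R : realType) (n : nat) (hn : (6 <= n)%N) :
  exists (r : nat) (p : 'I_r -> {mpoly R[n]}),
    (0 < r)%N /\
    (forall j, p j \is 2.-homog) /\
    (~ exists x : 'I_n -> R, nontrivial_zero p x) /\
    (forall a : 'I_r -> R, (forall j, 0 < a j) ->
       noncoercive_sos (\sum_(j < r) a j *: p j ^+ 2)).
Proof.
pose x : 'I_6 -> 'I_n := widen_ord hn.
have xI : injective x by move=> i j /(congr1 val) /= /val_inj.
pose P : seq {mpoly R[n]} := pentagon_quadrics x.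
exists (size P), (tnth (in_tuple P)).
have Phomog j : tnth (in_tuple P) j \is 2.-homog.
  exact/pentagon_quadrics_homog/mem_tnth.
split; first by [].
split; first exact: Phomog.
split=> [[v [[i vi] v0]]|a a_gt0].
  case/eqP: vi; apply: (pentagon_quadrics_real_zero x) => p.
  by move=> /(tnthP (in_tuple P))[j ->].
set f := \sum_(j < _) _.
have fhomog : f \is (2 + 2).-homog.
  by apply: rpred_sum => j _; apply: rpredZ; rewrite expr2 dhomogM.
have Lf : pentagon_functional x f = 0.
  rewrite pentagon_functional_sum big1 // => j _.
  by rewrite pentagon_quadrics_kernel ?mulr0 // mem_tnth.
split.
  split; first by exists (2 + 2)%N.
  exists (size P), (fun j => Num.sqrt (a j) *: tnth (in_tuple P) j).
  by apply: eq_bigr => j _; rewrite exprZn sqr_sqrtr // ltW.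
move=> m q fE; have qhomog : forall k, q k \is 2.-homog.
  by apply: sos_homog; rewrite -fE.
have Lq k : pentagon_functional x (q k ^+ 2) = 0.
  move: Lf; rewrite fE.
  rewrite (eq_bigr (fun k => 1 *: q k ^+ 2)) => [|i _]; last by rewrite scale1r.
  rewrite pentagon_functional_sum => /psumr_eq0P s0.
  rewrite -[LHS]mul1r s0 // => i _.
  by rewrite mul1r pentagon_functional_sqr_ge0.
(* The common zero (1, 'i, 0, ..., 0). *)
exists (fun k => (unitv (x 0) k)%:C%C + 'i%C * (unitv (x 1) k)%:C%C).
split=> [|k].
  by exists (x 0); rewrite /unitv !(inj_eq xI) /= mulr0 addr0 oner_eq0.
have [dE bE] := pentagon_functional_sqr_eq0 x (q k) (qhomog k) (Lq k).
exact: complexify_zero.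
Qed.
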